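(* Let $q$ be a prime power and $n$ a positive integer with $\gcd(n,q)=1$, and let $\mathbb{L}|\mathbb{F}_q$ be a field extension with $U_n\subseteq\mathbb{L}$. Let $C$ be a nonzero cyclic code in $\mathbb{F}_q(n)$. Then $d(C)=\Delta(C)$ if and only if there exist $k\in\{0,\dots,n-1\}$ and a divisor $g\mid x^n-1$ in $\mathbb{L}[x]$ such that, setting $f=\overline{x^kg}$, the following conditions hold: (1) $d^\ast(f)=d^\ast(C)$; (2) $\varphi^{-1}_{\alpha,f}\in C$ for some $\alpha\in\mathcal{R}(C)$.
   Context: $U_n$ is the set of primitive $n$-th roots of unity. For a field $F$, $F(n)=F[x]/(x^n-1)$; its elements are identified with polynomials of degree $<n$, and $\overline{f}$ is the image of $f\in F[x]$ in $F(n)$, i.e. its remainder modulo $x^n-1$. A cyclic code is an ideal $C$ of $\mathbb{F}_q(n)$; $\omega(c)$ is the number of nonzero coefficients of $c$, and $d(C)=\min\{\omega(c): 0\neq c\in C\}$. For $\alpha\in U_n$, the defining set is $D_\alpha(C)=\{i\in\mathbb{Z}_n : c(\alpha^i)=0 \text{ for all } c\in C\}$. The BCH bounds of $C$ are the integers $\delta$ such that, for some $\alpha\in U_n$, $D_\alpha(C)$ contains $\delta-1$ consecutive integers modulo $n$; $\Delta(C)$ is the maximum of the BCH bounds of $C$. For $f\in\mathbb{F}_q(n)$ (or $\mathbb{L}(n)$) and $\alpha\in U_n$, the Fourier transform is $\varphi_{\alpha,f}(x)=\sum_{j=0}^{n-1}f(\alpha^j)x^j\in\mathbb{L}(n)$,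 with inverse $\varphi^{-1}_{\alpha,g}(x)=\frac1n\sum_{i=0}^{n-1}g(\alpha^{-i})x^i$ for $g\in\mathbb{L}(n)$. The apparent distance of $g\in\mathbb{L}(n)$ is $d^\ast(0)=0$ and, for $g\ne0$, $d^\ast(g)=\max\{n-\deg(\overline{x^hg}): 0\le h\le n-1\}$. For a nonzero cyclic code $C$: $d^\ast_\alpha(C)=\min_{0\ne c\in C}d^\ast(\varphi_{\alpha,c})$, $d^\ast(C)=\max_{\alpha\in U_n}d^\ast_\alpha(C)$, and $\mathcal{R}(C)=\{\beta\in U_n: d^\ast_\beta(C)=d^\ast(C)\}$. It is a known fact (Camion) that $d^\ast(C)=\Delta(C)$. *)

(* Defs.v *)
From HB Require Import structures.
From mathcomp Require Import all_boot all_order all_algebra.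
From mathcomp Require Import qpoly boolp classical_sets.

Set Implicit Arguments.
Unset Strict Implicit.
Unset Printing Implicit Defensive.

Import Order.TTheory GRing.Theory.

Local Open Scope classical_set_scope.
Local Open Scope ring_scope.

(* Largest and smallest element of a set of naturals; 0 if there is none. *)
Definition natmax (A : set nat) : nat := xget 0%N (A `&` ubound A).
Definition natmin (A : set nat) : nat := xget 0%N (A `&` lbound A).

(* R(n) = R[x] / (x^n - 1). For n = 0, and only then, the library replaces the
   modulus by 'X. Elements coerce to their representative of degree < n. *)
Notation cyclic_ring R n := {poly %/ ('X^n - 1 : {poly R})}.

Definition cbar (R : comNzRingType) (n : nat) (p : {poly R}) : cyclic_ring R n :=
  in_qpoly ('X^n - 1) p.

Definition is_ideal (R : comNzRingType) (I : set R) : Prop :=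
  [/\ I 0, forall u v, I u -> I v -> I (u + v)
    & forall a u, I u -> I (a * u)].

Definition weight (R : comNzRingType) (n : nat) (c : cyclic_ring R n) : nat :=
  count (fun a => a != 0) (c : {poly R}).

Definition min_distance (R : comNzRingType) (n : nat)
    (C : set (cyclic_ring R n)) : nat :=
  natmin [set weight c | c in [set c | C c /\ c != 0]].

Definition primitive_roots (L : fieldType) (n : nat) : set L :=
  [set a | n.-primitive_root a].
Arguments primitive_roots : clear implicits.

(* An extension L | F is given by a ring morphism iota : F -> L. *)
Definition defining_set (F L : fieldType) (iota : {rmorphism F -> L}) (n : nat)
    (a : L) (C : set (cyclic_ring F n)) : set 'I_n :=
  [set i | forall c, C c -> (map_poly iota c).[a ^+ i] = 0].

Definition is_bch_bound (F L : fieldType) (iota : {rmorphism F -> L}) (n : nat)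
    (C : set (cyclic_ring F n)) (delta : nat) : Prop :=
  (0 < delta)%N /\
  exists2 a, primitive_roots L n a &
    exists b : nat, forall j, (j < delta.-1)%N ->
      exists2 i, defining_set iota a C i & i = b + j %[mod n].

Definition max_bch_bound (F L : fieldType) (iota : {rmorphism F -> L}) (n : nat)
    (C : set (cyclic_ring F n)) : nat :=
  natmax [set delta | is_bch_bound iota C delta].

Definition fourier (L : fieldType) (n : nat) (a : L) (f : {poly L}) :
    cyclic_ring L n :=
  cbar n (\sum_(j < n) f.[a ^+ j] *: 'X^j).

Definition inv_fourier (L : fieldType) (n : nat) (a : L)
    (g : cyclic_ring L n) : cyclic_ring L n :=
  cbar n (n%:R^-1 *: \sum_(i < n) (g : {poly L}).[a ^- i] *: 'X^i).

Definition apparent_distance (L : fieldType) (n : nat) (g : cyclic_ring L n) :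
    nat :=
  if g == 0 then 0%N else
  natmax [set (n - (size (cbar n ('X^h * (g : {poly L})) : {poly L})).-1)%N
         | h in [set h : nat | (h < n)%N]].

Definition apparent_distance_at (F L : fieldType) (iota : {rmorphism F -> L})
    (n : nat) (a : L) (C : set (cyclic_ring F n)) : nat :=
  natmin [set apparent_distance (fourier n a (map_poly iota c))
         | c in [set c | C c /\ c != 0]].

Definition code_apparent_distance (F L : fieldType)
    (iota : {rmorphism F -> L}) (n : nat) (C : set (cyclic_ring F n)) : nat :=
  natmax [set apparent_distance_at iota a C | a in primitive_roots L n].

Definition optimal_roots (F L : fieldType) (iota : {rmorphism F -> L})
    (n : nat) (C : set (cyclic_ring F n)) : set L :=
  [set b | primitive_roots L n b /\
           apparent_distance_at iota b C = code_apparent_distance iota C].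

(* The embedding F(n) -> L(n) that regards F(n) as a subset of L(n). *)
Definition extend_scalars (F L : fieldType) (iota : {rmorphism F -> L})
    (n : nat) (c : cyclic_ring F n) : cyclic_ring L n :=
  cbar n (map_poly iota c).

(* Main.v *)
(* Write W(f) for the weight of the inverse transform of f in L(n): it is n minus
   the number of n-th roots of unity at which f vanishes. These zeros are shared
   by every shift of f, so the degree of each shift is at least their number, and
   d*(f) <= W(f). Equality holds exactly when some shift of f has only these
   zeros, each once, i.e. divides x^n - 1, which means that f is the image of
   x^k g with g | x^n - 1. Hence d*_a(C) <= d(C), and by Camion's equality the
   BCH bound is sharp exactly when a minimum weight word has such a transform.
   For Camion's equality, both numbers count cyclic runs of zero coefficients of
   transforms, and the transform of a generator of C vanishes exactly on the
   defining set. *)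
Require Import Defs.
From HB Require Import structures.
From mathcomp Require Import all_boot all_order all_algebra.
From mathcomp Require Import qpoly boolp classical_sets zify.
Import Order.TTheory GRing.Theory.
Local Open Scope classical_set_scope.
Local Open Scope ring_scope.

(** * Extrema of sets of naturals *)

Lemma natmaxP {A : set nat} {m b : nat} :
  A m -> (forall x, A x -> (x <= b)%N) ->
  A (natmax A) /\ (forall x, A x -> (x <= natmax A)%N).
Proof.
move=> Am Ab; apply: (@xgetPex _ 0%N (A `&` ubound A)).
have exA : exists x, `[< A x >] by exists m; apply/asboolP.
have leA x : `[< A x >] -> (x <= b)%N by move/asboolP/Ab.
have [x /asboolP Ax max_x] := ex_maxnP exA leA.
by exists x; split=> // y Ay; rewrite leEnat; apply/max_x/asboolP.
Qed.

Lemma natminP {A : set nat} {m : nat} :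
  A m -> A (natmin A) /\ (forall x, A x -> (natmin A <= x)%N).
Proof.
move=> Am; apply: (@xgetPex _ 0%N (A `&` lbound A)).
have exA : exists x, `[< A x >] by exists m; apply/asboolP.
have [x /asboolP Ax min_x] := ex_minnP exA.
by exists x; split=> // y Ay; rewrite leEnat; apply/min_x/asboolP.
Qed.

(** * Representatives, cyclic shifts and weights modulo x^n - 1 *)

Section CyclicRing.

Context {R : comNzRingType} {n : nat} (n_gt0 : (0 < n)%N).
Implicit Types (p : {poly R}) (c : cyclic_ring R n).

Let mk_monicE : mk_monic ('X^n - 1 : {poly R}) = 'X^n - 1.
Proof. by rewrite /mk_monic size_Xn_sub_1 // monic_Xn_sub_1 // ltnS n_gt0. Qed.

Lemma size_cyclic c : (size (c : {poly R}) <= n)%N.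
Proof.
by rewrite -ltnS -(size_Xn_sub_1 R n_gt0) -{2}mk_monicE size_mk_monic.
Qed.

Lemma cbar_small {p} : (size p <= n)%N -> cbar n p = p :> {poly R}.
Proof. by move=> sp; rewrite in_qpoly_small // mk_monicE size_Xn_sub_1. Qed.

Lemma cbarK c : cbar n (c : {poly R}) = c.
Proof. exact/val_inj/cbar_small/size_cyclic. Qed.

Lemma cbarM p r : cbar n (p * r) = cbar n p * cbar n r.
Proof. exact: in_qpolyM. Qed.

Lemma cbar_modulus : cbar n ('X^n - 1 : {poly R}) = 0.
Proof.
apply: val_inj; rewrite /= mk_monicE.
by apply/Pdiv.RingMonic.rmodpp/monic_Xn_sub_1.
Qed.

Lemma horner_cbar p {z : R} : z ^+ n = 1 -> (cbar n p : {poly R}).[z] = p.[z].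
Proof.
move=> zn; rewrite /= mk_monicE.
rewrite [in RHS](Pdiv.RingMonic.rdivp_eq (monic_Xn_sub_1 R n_gt0) p).
by rewrite !hornerE zn subrr mulr0 add0r.
Qed.

Lemma cbarXn_addl (m : nat) : cbar n ('X^(n + m) : {poly R}) = cbar n 'X^m.
Proof.
have Xn1 : cbar n ('X^n : {poly R}) = cbar n 1.
  by apply/eqP; rewrite -subr_eq0 -cbar_modulus /cbar rmorphB.
by rewrite exprD cbarM Xn1 -cbarM mul1r.
Qed.

Lemma cbarXn (m : nat) : cbar n ('X^m) = 'X^(m %% n) :> {poly R}.
Proof.
rewrite [in LHS](divn_eq m n); elim: (m %/ n)%N => [|k IHk].
  by rewrite mul0n add0n cbar_small // size_polyXn ltn_mod.
by rewrite mulSn -addnA cbarXn_addl.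
Qed.

(** By linearity only monomials matter, and their exponents are reduced modulo [n]: multiplying by
    ['X^h] rotates the coefficients by [h] places. *)
Lemma coef_cbarXnM (h : nat) {j : nat} {p} :
  (size p <= n)%N -> (j < n)%N ->
  (cbar n ('X^h * p) : {poly R})`_((j + h) %% n) = p`_j.
Proof.
move=> sp ltjn; have -> : p = \poly_(i < n) p`_i.
  apply/polyP=> i; rewrite coef_poly; case: ltnP => // /(leq_trans sp).
  exact: nth_default.
rewrite poly_def mulr_sumr /cbar (raddf_sum (in_qpoly _)) /= poly_of_qpoly_sum.
rewrite coef_sum [in RHS]coef_sum; apply: eq_bigr => i _.
rewrite -scalerAr -exprD [in_qpoly _ _]in_qpolyZ [in LHS]/= !coefZ.
rewrite -[Pdiv.Ring.rmodp _ _]/(cbar n 'X^(h + i) : {poly R}) cbarXn !coefXn.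
by rewrite addnC eqn_modDl !modn_small.
Qed.

Lemma cyclicP {c c'} :
  (forall i : 'I_n, (c : {poly R})`_i = (c' : {poly R})`_i) -> c = c'.
Proof.
move=> eqcc'; apply/val_inj/polyP => i; have [ltin|leni] := ltnP i n.
  exact: (eqcc' (Ordinal ltin)).
by rewrite !nth_default // (leq_trans (size_cyclic _)).
Qed.

Lemma weightE c : weight c = #|[pred i : 'I_n | (c : {poly R})`_i != 0]|.
Proof.
rewrite /weight -sum1_count (big_nth 0) big_mkord -sum1_card.
rewrite (big_ord_widen_cond n (fun i => (c : {poly R})`_i != 0) (fun=> 1%N)) ?size_cyclic //.
apply: eq_bigl => i; rewrite inE andb_idr // ltnNge.
by apply: contra => /(nth_default 0) ->.
Qed.

End CyclicRing.

(** * Apparent distance and cyclic runs of zeros *)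

Lemma apparent_distance_attained {L : fieldType} {n : nat} (n_gt0 : (0 < n)%N)
    {f : cyclic_ring L n} : f != 0 ->
  (exists2 h, (h < n)%N & apparent_distance f =
     (n - (size (cbar n ('X^h * (f : {poly L})) : {poly L})).-1)%N) /\
  (forall h, (h < n)%N ->
     (n - (size (cbar n ('X^h * (f : {poly L})) : {poly L})).-1
        <= apparent_distance f)%N).
Proof.
move=> f_neq0; rewrite /apparent_distance (negPf f_neq0).
set A := [set _ | _ in _].
have [] := @natmaxP A (n - (size (cbar n ('X^0 * (f : {poly L})) : {poly L})).-1)%N n.
- by exists 0%N.
- by move=> _ [h _ <-]; exact: leq_subr.
case=> h hn <- leA; split; first by exists h.
by move=> h' h'n; apply: leA; exists h'.
Qed.

(** Two rotations whose amounts add up to 0 modulo [n] cancel. Reducing [n - h] modulo [n] keeps the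
    exponent below [n] even for [h = 0]. *)
Lemma cbar_shiftK {R : comNzRingType} {n : nat} (n_gt0 : (0 < n)%N)
    {h : nat} (f : cyclic_ring R n) : (h < n)%N ->
  f = cbar n ('X^((n - h) %% n) * (cbar n ('X^h * (f : {poly R})) : {poly R})).
Proof.
move=> lthn; apply: (cyclicP n_gt0) => i.
set p := cbar n ('X^h * _); have ltm (m : nat) : (m %% n < n)%N by rewrite ltn_mod.
have := coef_cbarXnM n_gt0 ((n - h) %% n) (size_cyclic n_gt0 p) (ltm (i + h)%N).
rewrite modnDm addnAC -addnA subnK ?(ltnW lthn) //.
rewrite modnDr (modn_small (ltn_ord i)) => ->.
by rewrite coef_cbarXnM // size_cyclic.
Qed.

(* A shift by h moves a cyclic run of zero coefficients to the top degrees, and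
   d* records the longest run so moved, plus one. *)
Lemma apparent_distanceP {L : fieldType} {n : nat} (n_gt0 : (0 < n)%N)
    {f : cyclic_ring L n} (delta : nat) : f != 0 ->
  (delta <= apparent_distance f)%N <->
  exists b : nat, forall j, (j < delta.-1)%N ->
    (f : {poly L})`_((b + j) %% n) = 0.
Proof.
move=> f_neq0; have [[h ltnh ->] le_dist] := apparent_distance_attained n_gt0 f_neq0.
split=> [le_delta|[b zero_f]].
  move: le_delta; set p := cbar n _ => le_delta.
  (* The coefficients of [p] vanish from index [size p] up to [n - 1]; rotating back by [h] gives
     the start of this run in [f]. *)
  exists (size (p : {poly L}) + (n - h))%N => j ltj.
  have p_neq0 : (0 < size (p : {poly L}))%N.
    rewrite lt0n size_poly_eq0; apply: contraNneq f_neq0 => p0.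
    by rewrite (cbar_shiftK n_gt0 f ltnh) -/p p0 mulr0 (cbarK n_gt0 0).
  have ltm (m : nat) : (m %% n < n)%N by rewrite ltn_mod.
  rewrite -(coef_cbarXnM n_gt0 h (size_cyclic n_gt0 f) (ltm _)) -/p nth_default //.
  rewrite modnDml.
  have -> : (size (p : {poly L}) + (n - h) + j + h = size (p : {poly L}) + j + n)%N by lia.
  move: le_delta p_neq0; move: (size _) => s le_delta s_gt0.
  by rewrite modnDr modn_small; lia.
(* A run of at least [n] zeros meets every index and would force [f = 0]. *)
have [delta_big|ltdn] := ltnP n delta.
  case/eqP: f_neq0; apply: (cyclicP n_gt0) => i; rewrite coef0.
  have lti := ltn_ord i.
  have ltb : (b %% n < n)%N by rewrite ltn_mod.
  have := zero_f ((i + (n - b %% n)) %% n)%N.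
  have -> : ((b + (i + (n - b %% n)) %% n) %% n = i)%N.
    rewrite modnDmr -modnDml.
    have -> : (b %% n + (i + (n - b %% n)) = i + n)%N by lia.
    by rewrite modnDr modn_small.
  by apply; have := ltn_mod (i + (n - b %% n)) n; lia.
have [->//|delta_gt0] := posnP delta.
have ltb : (b %% n < n)%N by rewrite ltn_mod.
(* This shift sends index [b] to [n - delta.-1], so the run fills the top [delta.-1] places;
   [n - b %% n] stands for [-b] modulo [n]. *)
pose h' := ((n - delta.-1 + (n - b %% n)) %% n)%N.
have lth' : (h' < n)%N by rewrite ltn_mod.
apply: leq_trans (le_dist _ lth').
suff : (size (cbar n ('X^h' * (f : {poly L})) : {poly L}) <= n - delta.-1)%N by lia.
apply/leq_sizeP => i lei; have [ltin|lein] := ltnP i n; last first.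
  by rewrite nth_default // (leq_trans (size_cyclic n_gt0 _)).
have ltj : (i - (n - delta.-1) < delta.-1)%N by lia.
rewrite -[RHS](zero_f _ ltj).
rewrite -(coef_cbarXnM n_gt0 h' (size_cyclic n_gt0 f)) ?ltn_mod //.
congr (_`_ _); rewrite modnDml /h' modnDmr -addnA -modnDml.
have -> : (b %% n + (i - (n - delta.-1) + (n - delta.-1 + (n - b %% n))) = i + n)%N by lia.
by rewrite modnDr modn_small.
Qed.

(** * Fourier inversion and zeros at roots of unity *)

Section Fourier.

Context {L : fieldType} {n : nat} {a : L} (prim_a : n.-primitive_root a).
Implicit Types (f g : cyclic_ring L n) (p : {poly L}).

Let n_gt0 : (0 < n)%N := prim_order_gt0 prim_a.
Let an1 : a ^+ n = 1 := prim_expr_order prim_a.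

Let a_neq0 : a != 0.
Proof. by rewrite (prim_root_eq0 prim_a) -lt0n. Qed.

Lemma coef_fourier p {j : nat} : (j < n)%N -> (fourier n a p : {poly L})`_j = p.[a ^+ j].
Proof.
move=> ltjn; rewrite /fourier -(poly_def n (fun j => p.[a ^+ j])).
by rewrite cbar_small ?size_poly // coef_poly ltjn.
Qed.

Lemma coef_inv_fourier g (i : nat) : (i < n)%N ->
  (inv_fourier a g : {poly L})`_i = n%:R^-1 * (g : {poly L}).[a ^- i].
Proof.
move=> ltin; rewrite /inv_fourier -(poly_def n (fun i => (g : {poly L}).[a ^- i])).
by rewrite cbar_small ?(leq_trans (size_scale_leq _ _)) ?size_poly // coefZ coef_poly ltin.
Qed.

(** Orthogonality of characters: for [k != i] the ratio w is not 1, while w - 1 times the geometric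
    sum is w^n - 1 = 0. *)
Lemma sum_prim_rootXn (i k : 'I_n) :
  \sum_(j < n) (a ^+ k * a ^- i) ^+ j = if k == i then n%:R else 0.
Proof.
have aU (m : nat) : a ^+ m != 0 by rewrite expf_neq0.
case: eqP => [->|neq_ki].
  rewrite mulfV // (eq_bigr (fun=> 1)); last by move=> j _; rewrite expr1n.
  by rewrite sumr_const card_ord.
apply: (@mulfI _ (a ^+ k * a ^- i - 1)).
  rewrite subr_eq0; apply/eqP => /(canRL (mulfVK (aU i))); rewrite mul1r => /eqP.
  by rewrite (eq_prim_root_expr prim_a) !modn_small // => /eqP/val_inj.
rewrite mulr0 -subrX1 exprMn exprVn -!exprM ![(_ * n)%N]mulnC !exprM an1 !expr1n.
by rewrite invr1 mulr1 subrr.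
Qed.

Lemma fourierK {p} : (size p <= n)%N -> inv_fourier a (fourier n a p) = cbar n p.
Proof.
move=> sp; apply: (cyclicP n_gt0) => i.
rewrite coef_inv_fourier // (cbar_small n_gt0 sp).
rewrite (horner_coef_wide _ (size_cyclic n_gt0 _)).
under eq_bigr => j _ do rewrite coef_fourier // (horner_coef_wide _ sp) mulr_suml.
(* With the sum over [j] inside, orthogonality leaves only the coefficient of index [i], multiplied
   by [n]. *)
rewrite exchange_big /=.
under eq_bigr => k _.
  under eq_bigr => j _.
    rewrite -mulrA -exprM mulnC exprM -exprMn; over.
  rewrite -mulr_sumr sum_prim_rootXn; over.
rewrite (bigD1 i) //= eqxx big1 => [|k /negPf ->]; last exact: mulr0.
(* A field with a primitive [n]-th root of unity has [n] invertible. *)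
by rewrite addr0 mulrC mulfK // (prim_root_natf_neq0 prim_a).
Qed.

(** The inverse powers are the evaluation points of [inv_fourier]; for primitive [a] they run
    through the [n]-th roots of unity once each. *)
Definition unity_zeros p : seq L := 
  [seq a ^- i | i : 'I_n in [pred i : 'I_n | root p (a ^- i)]].

Lemma unity_zeros_uniq p : uniq (unity_zeros p).
Proof.
rewrite map_inj_uniq ?enum_uniq // => i j /invr_inj/eqP.
by rewrite (eq_prim_root_expr prim_a) !modn_small // => /eqP/val_inj.
Qed.

Lemma unity_zerosP p : all (root p) (unity_zeros p).
Proof. by apply/allP=> _ /mapP[i + ->]; rewrite mem_enum. Qed.

Lemma weight_inv_fourier g : weight (inv_fourier a g) = (n - size (unity_zeros g))%N.
Proof.
rewrite (weightE n_gt0) size_map -cardE -[X in (X - _)%N]card_ord.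
rewrite -(cardC [pred i : 'I_n | root (g : {poly L}) (a ^- i)]) addKn.
apply: eq_card => i; rewrite !inE coef_inv_fourier // mulf_eq0.
by rewrite invr_eq0 (negPf (prim_root_natf_neq0 prim_a)).
Qed.

Let invX (i : nat) : (a ^- i) ^+ n = 1.
Proof. by rewrite exprVn -exprM mulnC exprM an1 expr1n invr1. Qed.

(** Reduction modulo x^n - 1 preserves values at [n]-th roots of unity, and ['X^h] is nonzero
    there. *)
Lemma unity_zeros_shift (h : nat) p :
  unity_zeros (cbar n ('X^h * p)) = unity_zeros p.
Proof.
congr map; apply: eq_enum => i; rewrite !inE /root (horner_cbar n_gt0) //.
by rewrite hornerM hornerXn mulf_eq0 expf_eq0 invr_eq0 expf_eq0 (negPf a_neq0) !andbF.
Qed.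

Lemma unity_zeros_modulus : size (unity_zeros ('X^n - 1)) = n.
Proof.
rewrite size_map -cardE -[RHS]card_ord; apply: eq_card => i.
by rewrite !inE /root !hornerE invX subrr eqxx.
Qed.

(** Write x^n - 1 = r p. Each of the [n] roots of unity is a zero of r or of p, and r has at most
    deg r of them, so at least n - deg r = deg p remain for p. *)
Lemma size_unity_zeros_dvdp {p} :
  p %| 'X^n - 1 -> ((size p).-1 <= size (unity_zeros p))%N.
Proof.
case/dvdpP=> r def_r.
have modulus_neq0 : r * p != 0 by rewrite -def_r -size_poly_gt0 size_Xn_sub_1.
have [r_neq0 p_neq0] : r != 0 /\ p != 0 by apply/norP; rewrite -mulf_eq0.
have size_rp : (size r + size p).-1 = n.+1.
  by rewrite -size_mul // -def_r size_Xn_sub_1.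
have zeros_r : (size (unity_zeros r) < size r)%N.
  exact: max_poly_roots r_neq0 (unity_zerosP r) (unity_zeros_uniq r).
have zeros_rp : (n <= size (unity_zeros r) + size (unity_zeros p))%N.
  rewrite -[leqLHS]unity_zeros_modulus !size_map -!cardE.
  rewrite -cardUI (leq_trans _ (leq_addr _ _)) // subset_leq_card //.
  by apply/fintype.subsetP=> i; rewrite !inE def_r rootM.
have : (0 < size p)%N by rewrite size_poly_gt0.
lia.
Qed.

Lemma apparent_distance_inv_fourier {f} : f != 0 ->
  (apparent_distance f <= weight (inv_fourier a f))%N /\
  (apparent_distance f = weight (inv_fourier a f) ->
   exists (k : 'I_n) (p : {poly L}), p %| 'X^n - 1 /\ f = cbar n ('X^k * p)).
Proof.
move=> f_neq0; have [[h lthn ->] _] := apparent_distance_attained n_gt0 f_neq0.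
rewrite weight_inv_fourier -(unity_zeros_shift h f).
set p := cbar n ('X^h * (f : {poly L})).
have def_f : f = cbar n ('X^((n - h) %% n) * (p : {poly L})).
  exact: cbar_shiftK.
have p_neq0 : (p : {poly L}) != 0.
  apply: contraNneq f_neq0 => p0.
  by rewrite def_f p0 mulr0 (cbarK n_gt0 0).
have size_p : (size (p : {poly L}) <= n)%N := size_cyclic n_gt0 p.
have zeros_p : (size (unity_zeros p) < size (p : {poly L}))%N.
  exact: max_poly_roots p_neq0 (unity_zerosP p) (unity_zeros_uniq p).
split; first by apply: leq_sub2l; rewrite -ltnS (leq_trans zeros_p) ?leqSpred.
(* Truncated subtraction can be cancelled here since both subtrahends are at most [n]. *)
have eq_size : (n - (size (p : {poly L})).-1 = n - size (unity_zeros p))%N ->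
    size (p : {poly L}) = (size (unity_zeros p)).+1 by lia.
move/eq_size => {}eq_size; have ltk : ((n - h) %% n < n)%N by rewrite ltn_mod.
exists (Ordinal ltk), (p : {poly L}); split=> //.
(* [G] divides [p] and now has the same degree, so the two are associates; the roots of [G] are
   distinct [n]-th roots of unity, so it divides x^n - 1. *)
set G := \prod_(z <- unity_zeros p) ('X - z%:P).
have G_dvd q : all (root q) (unity_zeros p) -> G %| q.
  by move=> rq; apply: uniq_roots_dvdp; rewrite // uniq_rootsE unity_zeros_uniq.
have /eqp_dvdl <- : G %= p.
  rewrite -dvdp_size_eqp ?G_dvd ?unity_zerosP //.
  by rewrite size_prod_XsubC eq_size.
by apply/G_dvd/allP => _ /mapP[i _ ->]; rewrite /root !hornerE invX subrr.
Qed.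

(** Undoing the shift by [k] leaves the image of [p], of degree at most deg p, which the zeros of
    [p] at roots of unity already account for. *)
Lemma weight_inv_fourier_dvdp {k : 'I_n} {p} :
  p %| 'X^n - 1 -> cbar n ('X^k * p) != 0 ->
  (weight (inv_fourier a (cbar n ('X^k * p)))
     <= apparent_distance (cbar n ('X^k * p)))%N.
Proof.
move=> p_dvd f_neq0.
rewrite weight_inv_fourier unity_zeros_shift.
have [_ le_dist] := apparent_distance_attained n_gt0 f_neq0.
have size_zeros := size_unity_zeros_dvdp p_dvd.
have lthn : ((n - k) %% n < n)%N by rewrite ltn_mod.
apply: leq_trans (le_dist _ lthn); apply: leq_sub2l.
apply: leq_trans size_zeros.
have -> : cbar n ('X^((n - k) %% n) * (cbar n ('X^k * p) : {poly L})) = cbar n p.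
  rewrite cbarM cbarK // (cbarM 'X^k) mulrA -cbarM.
  have -> : cbar n ('X^((n - k) %% n) * 'X^k : {poly L}) = 1.
    rewrite -exprD; apply: val_inj; rewrite /= -[LHS]/(cbar n 'X^_ : {poly L}).
    by rewrite cbarXn // modnDml subnK ?modnn // ltnW.
  by rewrite mul1r.
have le_cbar : (size (cbar n p : {poly L}) <= size p)%N.
  have [/(cbar_small n_gt0) -> //|/ltnW] := leqP (size p) n.
  exact/leq_trans/size_cyclic.
have : ((size (cbar n p : {poly L})).-1 <= (size p).-1)%N by lia.
exact.
Qed.

End Fourier.

Lemma apparent_distance_gt0 {L : fieldType} {n : nat} (n_gt0 : (0 < n)%N)
    {f : cyclic_ring L n} : f != 0 -> (0 < apparent_distance f)%N.
Proof. by move=> f_neq0; apply/(apparent_distanceP n_gt0 1%N f_neq0); exists 0%N. Qed.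

(** Take a nonzero element of least degree: the remainder of any other element by it lies in the
    ideal and must vanish. Divisibility holds between representatives, so roots of [c0] in an
    extension are roots of every element of [C]. *)
Lemma ideal_generator {F : fieldType} {n : nat} (n_gt0 : (0 < n)%N)
    {C : set (cyclic_ring F n)} :
  is_ideal C -> (exists2 c, C c & c != 0) ->
  exists c0, [/\ C c0, c0 != 0 &
    forall c, C c -> (c0 : {poly F}) %| (c : {poly F})].
Proof.
case=> C0 CD CM [c1 Cc1 c1_neq0].
pose A := [set size (c : {poly F}) | c in [set c | C c /\ c != 0]].
have [|[c0 [Cc0 c0_neq0] size_c0] min_c0] := @natminP A (size (c1 : {poly F})).
  by exists c1.
exists c0; split=> // c Cc; apply: contraT => ndvd.
pose r := (c : {poly F}) %% (c0 : {poly F}).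
have lt_r : (size r < size (c0 : {poly F}))%N by rewrite ltn_modp.
have size_r : (size r <= n)%N.
  by apply: ltnW (leq_trans lt_r _); apply: size_cyclic.
pose q := cbar n ((c : {poly F}) %/ (c0 : {poly F})).
have def_c : c = q * c0 + cbar n r.
  rewrite -{1}(cbarK n_gt0 c) {1}(divp_eq (c : {poly F}) (c0 : {poly F})).
  by rewrite [LHS]in_qpolyD [in_qpoly _ (_ * _)]cbarM cbarK.
have def_r : cbar n r = - q * c0 + c.
  by rewrite mulNr; apply: (canRL (addKr (q * c0))); rewrite -def_c.
suff : A (size r).
  by move/min_c0; rewrite -size_c0 leqNgt lt_r.
exists (cbar n r); last by rewrite (cbar_small n_gt0 size_r).
split; first by rewrite def_r; apply: CD => //; apply: CM.
apply: contra ndvd => /eqP r0; apply/modp_eq0P.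
by rewrite -/r -(cbar_small n_gt0 size_r) r0.
Qed.

(** * Distances of a cyclic code and Camion's equality *)

Section CyclicCode.

Context {F L : fieldType} (iota : {rmorphism F -> L}) {n : nat}.
Context {C : set (cyclic_ring F n)} (n_gt0 : (0 < n)%N).
Implicit Types (c : cyclic_ring F n) (a : L).

Lemma extend_scalarsE c :
  extend_scalars iota c = map_poly iota (c : {poly F}) :> {poly L}.
Proof. by apply: cbar_small => //; rewrite size_map_poly size_cyclic. Qed.

Lemma extend_scalars_eq0 c : (extend_scalars iota c == 0) = (c == 0).
Proof.
apply/eqP/eqP => [c0|->]; last by rewrite /extend_scalars rmorph0 (cbarK n_gt0 0).
apply/val_inj/(map_poly_inj iota).
by rewrite -[LHS]extend_scalarsE c0 rmorph0.
Qed.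

Lemma weight_extend_scalars c : weight (extend_scalars iota c) = weight c.
Proof.
rewrite !weightE //; apply: eq_card => i.
by rewrite !inE extend_scalarsE coef_map fmorph_eq0.
Qed.

Lemma fourier_extendK a c : n.-primitive_root a ->
  inv_fourier a (fourier n a (map_poly iota (c : {poly F}))) = extend_scalars iota c.
Proof. by move=> prim_a; rewrite fourierK // size_map_poly size_cyclic. Qed.

Lemma fourier_neq0 {a c} : n.-primitive_root a -> c != 0 ->
  fourier n a (map_poly iota (c : {poly F})) != 0.
Proof.
move=> prim_a; apply: contraNneq => f0; rewrite -extend_scalars_eq0.
rewrite -(fourier_extendK a) // f0; apply/eqP/(cyclicP n_gt0) => i.
by rewrite coef_inv_fourier // horner0 mulr0 coef0.
Qed.

Context (C_neq0 : exists2 c, C c & c != 0).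

Lemma min_distanceP :
  (exists c, [/\ C c, c != 0 & min_distance C = weight c]) /\
  (forall c, C c -> c != 0 -> (min_distance C <= weight c)%N).
Proof.
have [c Cc c_neq0] := C_neq0.
pose A := [set weight c | c in [set c | C c /\ c != 0]].
have [|[c' [Cc' c'_neq0] wc'] minA] := @natminP A (weight c); first by exists c.
split; first by exists c'; rewrite wc'.
by move=> d Cd d_neq0; apply: minA; exists d.
Qed.

Lemma apparent_distance_atP a :
  (exists c, [/\ C c, c != 0 & apparent_distance_at iota a C =
      apparent_distance (fourier n a (map_poly iota (c : {poly F})))]) /\
  (forall c, C c -> c != 0 -> (apparent_distance_at iota a C <=
      apparent_distance (fourier n a (map_poly iota (c : {poly F}))))%N).
Proof.
have [c Cc c_neq0] := C_neq0.
pose d c := apparent_distance (fourier n a (map_poly iota (c : {poly F}))).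
pose A := [set d c | c in [set c | C c /\ c != 0]].
have [|[c' [Cc' c'_neq0] wc'] minA] := @natminP A (d c); first by exists c.
split; first by exists c'; split=> //; rewrite -/(d c') wc'.
by move=> c1 Cc1 c1_neq0; apply: minA; exists c1.
Qed.

Lemma apparent_distance_at_le_weight {a c} : n.-primitive_root a ->
  C c -> c != 0 -> (apparent_distance_at iota a C <= weight c)%N.
Proof.
move=> prim_a Cc c_neq0.
have [_ /(_ c Cc c_neq0) le_d] := apparent_distance_atP a.
apply: leq_trans le_d _.
have [le_w _] := apparent_distance_inv_fourier prim_a (fourier_neq0 prim_a c_neq0).
by rewrite -weight_extend_scalars -(fourier_extendK a).
Qed.

Lemma weight_le c : (weight c <= n)%N.
Proof. by rewrite weightE // (leq_trans (max_card _)) ?card_ord. Qed.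

Context (prim_ex : exists a : L, n.-primitive_root a).

Lemma code_apparent_distanceP :
  (exists a, optimal_roots iota C a) /\
  (forall a, n.-primitive_root a ->
     (apparent_distance_at iota a C <= code_apparent_distance iota C)%N).
Proof.
have [a prim_a] := prim_ex; have [c Cc c_neq0] := C_neq0.
pose A := [set apparent_distance_at iota a C | a in primitive_roots L n].
have [||[b prim_b eq_b] maxA] := @natmaxP A (apparent_distance_at iota a C) n.
- by exists a.
- move=> _ [b prim_b <-].
  exact: leq_trans (apparent_distance_at_le_weight prim_b Cc c_neq0) (weight_le c).
split; first by exists b; split.
by move=> b' prim_b'; apply: maxA; exists b'.
Qed.

Context (C_ideal : is_ideal C).

(** The transform of a generator has a run of d*_a(C) - 1 zeros. Its indices are roots of the
    generator, hence of all codewords, and so lie in the defining set. *)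
Lemma bch_bound_apparent_distance_at {a} : n.-primitive_root a ->
  is_bch_bound iota C (apparent_distance_at iota a C).
Proof.
move=> prim_a; split.
  have [[c [_ c_neq0 ->]] _] := apparent_distance_atP a.
  exact/apparent_distance_gt0/fourier_neq0.
exists a => //; have [c0 [Cc0 c0_neq0 c0_dvd]] := ideal_generator n_gt0 C_ideal C_neq0.
have [_ /(_ c0 Cc0 c0_neq0)] := apparent_distance_atP a.
have f_neq0 := fourier_neq0 prim_a c0_neq0.
case/(apparent_distanceP n_gt0 _ f_neq0) => b zero_f; exists b => j /zero_f.
have ltm : ((b + j) %% n < n)%N by rewrite ltn_mod.
rewrite coef_fourier // => c0_root; exists (Ordinal ltm); last by rewrite /= modn_mod.
move=> c /c0_dvd; rewrite -(dvdp_map iota) => c0_dvd_c.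
apply/rootP; rewrite -dvdp_XsubCl (dvdp_trans _ c0_dvd_c) //.
by rewrite dvdp_XsubCl; apply/rootP.
Qed.

(** A run in the defining set for [a] is a run of zeros in the transform of every codeword, in
    particular of one attaining d*_a(C). *)
Lemma bch_bound_le {delta : nat} :
  is_bch_bound iota C delta -> (delta <= code_apparent_distance iota C)%N.
Proof.
case=> _ [a prim_a [b zero_C]].
have [_ /(_ a prim_a)] := code_apparent_distanceP.
apply: leq_trans; have [[c [Cc c_neq0 ->]] _] := apparent_distance_atP a.
apply/(apparent_distanceP n_gt0 _ (fourier_neq0 prim_a c_neq0)).
exists b => j /zero_C [i /(_ c Cc) ci def_i].
by rewrite coef_fourier ?ltn_mod // -def_i modn_small.
Qed.

Lemma code_apparent_distanceE : code_apparent_distance iota C = max_bch_bound iota C.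
Proof.
have [[a [prim_a eq_a]] _] := code_apparent_distanceP.
have bch_a := bch_bound_apparent_distance_at prim_a.
have [bch_max le_max] := @natmaxP [set d | is_bch_bound iota C d] _ _ bch_a (@bch_bound_le).
by apply/eqP; rewrite eqn_leq -{1}eq_a (le_max _ bch_a) (bch_bound_le bch_max).
Qed.

End CyclicCode.

Theorem corollary15 (F : finFieldType) (n : nat) (L : fieldType)
    (iota : {rmorphism F -> L}) (C : set (cyclic_ring F n)) :
  (0 < n)%N -> coprime n #|F| ->
  (exists z : L, n.-primitive_root z) ->
  is_ideal C -> (exists2 c, C c & c != 0) ->
  min_distance C = max_bch_bound iota C
  <->
  exists (k : 'I_n) (g : {poly L}),
    g %| 'X^n - 1 /\
    let f : cyclic_ring L n := cbar n ('X^k * g) in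
    apparent_distance f = code_apparent_distance iota C /\
    exists2 a, optimal_roots iota C a &
      exists2 c, C c & extend_scalars iota c = inv_fourier a f.
Proof.
move=> n_gt0 _ prim_ex C_ideal C_neq0.
rewrite -(code_apparent_distanceE iota n_gt0 C_neq0 prim_ex C_ideal).
have [[c0 [Cc0 c0_neq0 dist_c0]] min_dist] := min_distanceP C_neq0.
have [[a [prim_a opt_a]] max_a] := code_apparent_distanceP iota n_gt0 C_neq0 prim_ex.
split=> [eq_dist|[k [g [g_dvd /= [dist_f [b [prim_b opt_b] [c Cc ext_c]]]]]]].
  have f_neq0 := fourier_neq0 iota n_gt0 prim_a c0_neq0.
  have [le_w eq_w] := apparent_distance_inv_fourier prim_a f_neq0.
  have [_ /(_ c0 Cc0 c0_neq0) le_f] := apparent_distance_atP iota C_neq0 a.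
  rewrite (fourier_extendK iota n_gt0) // weight_extend_scalars // in le_w eq_w.
  (* The chain d*(f) <= weight c0 = d(C) = d*(C) = d*_a(C) <= d*(f) closes up, which is the equality
     case giving [k] and [g]. *)
  have eq_f : apparent_distance (fourier n a (map_poly iota (c0 : {poly F}))) = weight c0.
    by apply/eqP; rewrite eqn_leq le_w -dist_c0 eq_dist -opt_a.
  have [k [g [g_dvd def_f]]] := eq_w eq_f.
  exists k, g; split=> //=; rewrite -def_f; split; first by rewrite eq_f -dist_c0.
  by exists a => //; exists c0; rewrite // fourier_extendK.
(* Positivity excludes [f = 0], whose apparent distance is 0 by convention, and later [c = 0]. *)
have dist_gt0 : (0 < code_apparent_distance iota C)%N.
  rewrite -opt_a; have [[c1 [_ c1_neq0 ->]] _] := apparent_distance_atP iota C_neq0 a.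
  exact/apparent_distance_gt0/fourier_neq0.
have f_neq0 : cbar n ('X^k * g) != 0.
  by apply: contraTneq dist_gt0 => f0; rewrite -dist_f /apparent_distance f0 eqxx.
have [le_w _] := apparent_distance_inv_fourier prim_b f_neq0.
have ge_w := weight_inv_fourier_dvdp prim_b g_dvd f_neq0.
rewrite dist_f -ext_c weight_extend_scalars // in le_w ge_w.
have c_neq0 : c != 0.
  apply: contraTneq (leq_trans dist_gt0 le_w) => ->.
  by rewrite weightE // eq_card0 // => i; rewrite !inE coef0 eqxx.
(* One direction is d(C) <= weight c <= d*(f) = d*(C); the other is d*(C) = d*_a(C) <= weight c0 =
   d(C). *)
apply/eqP; rewrite eqn_leq (leq_trans (min_dist _ Cc c_neq0) ge_w) dist_c0 -opt_a.
exact: apparent_distance_at_le_weight.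
Qed.
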